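(* Let $k$ be a field with $u(k)\leq 2$ which is not quadratically closed, with $\mathrm{char}(k)\neq 2$ and $|k|\geq 5$. Let $G:=\mathrm{PSL}_2(k)$. Let $\mathscr{C}_1$ be the semisimple conjugacy class of $\bar{x}\in G$, where $x\in \mathrm{SL}_2(k)$. Let $\overline{\epsilon}\in k^{\times}/k^{\times 2}$ and let $\mathscr{C}_2$ be the unipotent conjugacy class of $\overline{\begin{pmatrix}1 & \epsilon\\ 0 & 1\end{pmatrix}}$ in $G$. (1) If $\mathrm{tr}(x)\neq 0$ or $-1\in k^{\times 2}$, then $$\mathscr{C}_1\mathscr{C}_2=\{\text{semisimple elements}\}\cup \{(\overline{\epsilon},\bar{x})\text{-admissible unipotent elements}\}.$$ (2) If $\mathrm{tr}(x)=0$ and $-1\notin k^{\times 2}$ (whence $\mathscr{C}_1$ is a non-split semisimple class), then $$\mathscr{C}_1\mathscr{C}_2=\{\text{semisimple elements not in }\mathscr{C}_1\}\cup \{(\overline{\epsilon},\bar{x})\text{-admissible unipotent elements}\}.$$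
   Context: A field $k$ has $u(k)\leq 2$ if every quadratic form in $3$ variables over $k$ is isotropic. A field is quadratically closed if it admits no quadratic extension. $k^{\times 2}$ is the set of squares in $k^\times$, and $\bar\epsilon$ denotes the image of $\epsilon\in k^\times$ in $k^\times/k^{\times2}$. For $x\in\mathrm{SL}_2(k)$, $\bar x$ is its image in $\mathrm{PSL}_2(k)=\mathrm{SL}_2(k)/\{\pm I\}$. Semisimple elements of $\mathrm{PSL}_2(k)$ are the images of non-central semisimple elements of $\mathrm{SL}_2(k)$; such an element $\bar x$ is non-split if the characteristic polynomial of $x$ is irreducible over $k$. Products of classes are $\mathscr{C}_1\mathscr{C}_2=\{ab: a\in\mathscr{C}_1,b\in\mathscr{C}_2\}$. For a semisimple $\bar x\in \mathrm{PSL}_2(k)$ (with $x\in\mathrm{SL}_2(k)$) and $\overline{\epsilon}\in k^\times/k^{\times2}$, let $$\Delta_{\overline{\epsilon},\bar{x}}:=\{\overline{\epsilon_1}\in k^{\times}/k^{\times 2}\mid \text{at least one of } \mathrm{tr}(x)-2 \text{ or } -\mathrm{tr}(x)-2 \text{ belongs to } \epsilon\epsilon_1k^{\times 2}\}.$$ For $y\in \mathrm{SL}_2(k)$, $\bar{y}$ is an $(\overline{\epsilon},\bar{x})$-admissible unipotent element if $\bar{y}$ is conjugate in $\mathrm{PSL}_2(k)$ to $\overline{\begin{pmatrix}1 & \epsilon_1\\0 & 1\end{pmatrix}}$ for some $\overline{\epsilon_1}\in \Delta_{\overline{\epsilon},\bar{x}}$. *)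

(* Defs.v *)
From HB Require Import structures.
From mathcomp Require Import all_boot all_order all_algebra all_field.
From mathcomp Require Import boolp classical_sets cardinality.

Set Implicit Arguments.
Unset Strict Implicit.
Unset Printing Implicit Defensive.

Import GRing.Theory.
Local Open Scope classical_set_scope.
Local Open Scope ring_scope.
Local Open Scope quotient_scope.

(* The form with coefficients A i j; A need not be symmetric, so every
   homogeneous quadratic polynomial is of this shape. *)
Definition quad_form (k : fieldType) n (A : 'M[k]_n) (v : 'rV[k]_n) : k :=
  \sum_(i < n) \sum_(j < n) A i j * v 0 i * v 0 j.

Definition isotropic (k : fieldType) n (A : 'M[k]_n) : Prop :=
  exists2 v : 'rV[k]_n, v != 0 & quad_form A v = 0.

Definition u_le2 (k : fieldType) : Prop := forall A : 'M[k]_3, isotropic A.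

Definition quadratically_closed (k : fieldType) : Prop :=
  ~ exists L : fieldExtType k, \dim {:L} = 2%N.

Definition squares (k : fieldType) : set k :=
  [set t ^+ 2 | t in [set t : k | t != 0]].
Arguments squares k : clear implicits.

(* The class of e != 0 in k^* / k^*2, as the coset e k^*2. *)
Definition sqclass (k : fieldType) (e : k) : set k :=
  [set e * s | s in squares k].

Record SL2 (k : fieldType) := MkSL2 {
  SL2_mx :> 'M[k]_2;
  SL2_det : \det SL2_mx == 1
}.

HB.instance Definition _ (k : fieldType) := [isSub for @SL2_mx k].
HB.instance Definition _ (k : fieldType) := [Choice of SL2 k by <:].

Section SL2Group.
Variable k : fieldType.
Implicit Types x y : SL2 k.

Lemma SL2_one_det : \det (1%:M : 'M[k]_2) == 1.
Proof. by rewrite det1. Qed.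

Lemma SL2_mul_det x y : \det (SL2_mx x *m SL2_mx y) == 1.
Proof. by rewrite det_mulmx (eqP (SL2_det x)) (eqP (SL2_det y)) mulr1. Qed.

Lemma SL2_inv_det x : \det (invmx (SL2_mx x)) == 1.
Proof. by rewrite det_inv (eqP (SL2_det x)) invr1. Qed.

Lemma SL2_opp_det x : \det (- SL2_mx x) == 1.
Proof. by rewrite -scaleN1r detZ sqrrN expr1n mul1r SL2_det. Qed.

Definition SL2_one : SL2 k := MkSL2 SL2_one_det.
Definition SL2_mul x y : SL2 k := MkSL2 (SL2_mul_det x y).
Definition SL2_inv x : SL2 k := MkSL2 (SL2_inv_det x).
Definition SL2_opp x : SL2 k := MkSL2 (SL2_opp_det x).

Lemma SL2_unit x : SL2_mx x \in unitmx.
Proof. by rewrite unitmxE (eqP (SL2_det x)) unitr1. Qed.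

Lemma SL2_mulA : associative SL2_mul.
Proof. by move=> x y z; apply: val_inj; rewrite /= mulmxA. Qed.

Lemma SL2_mul1 : left_id SL2_one SL2_mul.
Proof. by move=> x; apply: val_inj; rewrite /= mul1mx. Qed.

Lemma SL2_mulr1 : right_id SL2_one SL2_mul.
Proof. by move=> x; apply: val_inj; rewrite /= mulmx1. Qed.

Lemma SL2_mulV : left_inverse SL2_one SL2_inv SL2_mul.
Proof. by move=> x; apply: val_inj; rewrite /= mulVmx // SL2_unit. Qed.

Lemma SL2_mulrV : right_inverse SL2_one SL2_inv SL2_mul.
Proof. by move=> x; apply: val_inj; rewrite /= mulmxV // SL2_unit. Qed.

End SL2Group.

HB.instance Definition _ (k : fieldType) := isGroup.Build (SL2 k)
  (@SL2_mulA k) (@SL2_mul1 k) (@SL2_mulr1 k) (@SL2_mulV k) (@SL2_mulrV k).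

Section PSL2Def.
Variable k : fieldType.
Implicit Types x y : SL2 k.

Definition eq_upto_sign x y : bool := (x == y) || (x == SL2_opp y).

Lemma SL2_oppK : involutive (@SL2_opp k).
Proof. by move=> x; apply: val_inj; rewrite /= opprK. Qed.

Lemma eq_upto_sign_refl : reflexive eq_upto_sign.
Proof. by move=> x; rewrite /eq_upto_sign eqxx. Qed.

Lemma eq_upto_sign_sym : symmetric eq_upto_sign.
Proof.
move=> x y; rewrite /eq_upto_sign eq_sym; congr (_ || _).
by apply/eqP/eqP => ->; rewrite SL2_oppK.
Qed.

Lemma eq_upto_sign_trans : transitive eq_upto_sign.
Proof.
move=> y x z; rewrite /eq_upto_sign.
case/orP=> /eqP-> /orP[] /eqP->; rewrite ?SL2_oppK ?eqxx ?orbT //.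
Qed.

Canonical eq_upto_sign_equiv :=
  EquivRel eq_upto_sign eq_upto_sign_refl eq_upto_sign_sym eq_upto_sign_trans.

Definition PSL2 := {eq_quot eq_upto_sign}.

HB.instance Definition _ := Choice.on PSL2.
HB.instance Definition _ := EqQuotient.on PSL2.

Definition psl x : PSL2 := \pi_PSL2 x.

Lemma pslP x y : reflect (psl x = psl y) (eq_upto_sign x y).
Proof. by apply: (iffP idP) => [h|/eqmodP//]; apply/eqmodP. Qed.

Definition PSL2_one : PSL2 := psl 1%g.
Definition PSL2_mul (g h : PSL2) : PSL2 := psl (repr g * repr h)%g.
Definition PSL2_inv (g : PSL2) : PSL2 := psl (repr g)^-1%g.

Lemma SL2_opp_mull x y : (SL2_opp x * y)%g = SL2_opp (x * y)%g.
Proof. by apply: val_inj; rewrite /= mulNmx. Qed.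

Lemma SL2_opp_mulr x y : (x * SL2_opp y)%g = SL2_opp (x * y)%g.
Proof. by apply: val_inj; rewrite /= mulmxN. Qed.

Lemma SL2_opp_inv x : ((SL2_opp x)^-1)%g = SL2_opp (x^-1)%g.
Proof.
by apply: (@mulgI _ (SL2_opp x)); rewrite mulgV SL2_opp_mull SL2_opp_mulr SL2_oppK mulgV.
Qed.

Lemma psl_opp x : psl (SL2_opp x) = psl x.
Proof. by apply/pslP; rewrite /eq_upto_sign eqxx orbT. Qed.

Lemma repr_psl x : repr (psl x) = x \/ repr (psl x) = SL2_opp x.
Proof.
have /pslP : psl (repr (psl x)) = psl x by rewrite /psl reprK.
by case/orP=> /eqP; [left | right].
Qed.

Lemma pslM x y : psl (x * y)%g = PSL2_mul (psl x) (psl y).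
Proof.
rewrite /PSL2_mul; case: (repr_psl x) => ->; case: (repr_psl y) => -> //;
by rewrite ?SL2_opp_mull ?SL2_opp_mulr ?psl_opp.
Qed.

Lemma pslV x : psl (x^-1)%g = PSL2_inv (psl x).
Proof.
by rewrite /PSL2_inv; case: (repr_psl x) => -> //; rewrite SL2_opp_inv psl_opp.
Qed.

Lemma pslW (P : PSL2 -> Prop) : (forall x, P (psl x)) -> forall g, P g.
Proof. by move=> h g; rewrite -(reprK g); exact: h. Qed.

Lemma PSL2_mulA : associative PSL2_mul.
Proof.
elim/pslW=> x; elim/pslW=> y; elim/pslW=> z.
by rewrite -!pslM mulgA.
Qed.

Lemma PSL2_mul1 : left_id PSL2_one PSL2_mul.
Proof. by elim/pslW=> x; rewrite -pslM mul1g. Qed.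

Lemma PSL2_mulr1 : right_id PSL2_one PSL2_mul.
Proof. by elim/pslW=> x; rewrite -pslM mulg1. Qed.

Lemma PSL2_mulV : left_inverse PSL2_one PSL2_inv PSL2_mul.
Proof. by elim/pslW=> x; rewrite -pslV -pslM mulVg. Qed.

Lemma PSL2_mulrV : right_inverse PSL2_one PSL2_inv PSL2_mul.
Proof. by elim/pslW=> x; rewrite -pslV -pslM mulgV. Qed.

HB.instance Definition _ := isGroup.Build PSL2
  PSL2_mulA PSL2_mul1 PSL2_mulr1 PSL2_mulV PSL2_mulrV.

End PSL2Def.

Definition conj_class (G : groupType) (g : G) : set G :=
  [set (g ^ h)%g | h in [set: G]].

Definition class_mul (G : groupType) (A B : set G) : set G :=
  [set (a * b)%g | a in A & b in B].

(* A matrix is semisimple when it becomes diagonalizable over some extension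
   field (equivalently, over an algebraic closure). *)
Definition semisimple_mx (k : fieldType) n (A : 'M[k]_n) : Prop :=
  exists (L : fieldType) (f : {rmorphism k -> L}), diagonalizable (map_mx f A).

Definition noncentral (k : fieldType) (x : SL2 k) : Prop :=
  ~ forall y : SL2 k, commute x y.

Definition semisimple (k : fieldType) : set (PSL2 k) :=
  [set psl x | x in [set x : SL2 k | semisimple_mx x /\ noncentral x]].
Arguments semisimple k : clear implicits.

Definition nonsplit_semisimple (k : fieldType) : set (PSL2 k) :=
  [set psl x | x in [set x : SL2 k |
    [/\ semisimple_mx x, noncentral x & irreducible_poly (char_poly x)]]].
Arguments nonsplit_semisimple k : clear implicits.

Definition unip_mx (k : fieldType) (e : k) : 'M[k]_2 :=
  1%:M + e *: delta_mx 0 1.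

Lemma unip_mx_det (k : fieldType) (e : k) : \det (unip_mx e) == 1.
Proof. rewrite (expand_det_row _ 1) big_ord_recl big_ord1 /cofactor !det_mx11 !mxE /=.
by rewrite ?(mulr0, mulr1, addr0, add0r, mul0r, mul1r) expr2 mulrNN mulr1. Qed.

Definition unip (k : fieldType) (e : k) : SL2 k := MkSL2 (unip_mx_det e).

Definition Delta (k : fieldType) (e : k) (x : SL2 k) : set (set k) :=
  [set sqclass e1 | e1 in [set e1 : k | e1 != 0 /\
     (sqclass (e * e1) (\tr x - 2) \/ sqclass (e * e1) (- \tr x - 2))]].

Definition admissible (k : fieldType) (e : k) (x : SL2 k) : set (PSL2 k) :=
  [set psl y | y in [set y : SL2 k |
     exists e1 : k, [/\ e1 != 0, Delta e x (sqclass e1)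
                      & conj_class (psl (unip e1)) (psl y)]]].

(* Delta e x depends only on the square class of e and the image of x in
   PSL2. *)
Lemma Delta_sqclass (k : fieldType) (e e' : k) (x : SL2 k) :
  sqclass e = sqclass e' -> Delta e x = Delta e' x.
Proof.
suff sub a b : sqclass a = sqclass b -> Delta a x `<=` Delta b x.
  by move=> h; apply/seteqP; split; apply: sub.
move=> h _ [e1 [e1n0 d] <-]; exists e1 => //; split=> //.
have tr c : sqclass (a * e1) c -> sqclass (b * e1) c.
  case=> s sS <-; have : sqclass b (a * s) by rewrite -h; exists s.
  by case=> t tS bt; exists t => //; rewrite mulrAC bt mulrAC.
by case: d => /tr; [left | right].
Qed.

Lemma Delta_psl (k : fieldType) (e : k) (x y : SL2 k) :
  psl x = psl y -> Delta e x = Delta e y.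
Proof.
move=> /pslP/orP[]/eqP-> //; rewrite /Delta /= raddfN opprK.
by congr image; apply/seteqP; split=> z /= [? []]; split; auto.
Qed.

(* Main.v *)
Require Import Defs.
From HB Require Import structures.
From mathcomp Require Import all_boot all_order all_algebra all_field.
From mathcomp Require Import boolp classical_sets cardinality.
From mathcomp Require Import ring.

(* Since u(k) <= 2, nondegenerate binary quadratic forms are universal, so an
   element of SL2(k) with tr^2 <> 4 is conjugate to the companion matrix of its
   characteristic polynomial: semisimple classes are determined by the trace.
   If tr(y) = tr(x) then y u(e) has trace tr(x) + e y_{10}.  Any nonzero value of
   y_{10} occurs, hence every trace s <> tr(x) occurs; passing to -s handles
   s = tr(x) <> 0, and s = tr(x) = 0 forces y_{10} = 0, hence -1 to be a square.
   When the trace is 2, y u(e) is conjugate to u(- y_{10}), and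
   tr(x) - 2 = e (- y_{10}); the trace -2 case is the same with -y for y. *)

Import GRing.Theory.
Local Open Scope classical_set_scope.
Local Open Scope ring_scope.

(** * Two-by-two matrices in coordinates *)

Lemma big_ord2 {R : nmodType} (F : 'I_2 -> R) : \sum_(i < 2) F i = F 0 + F 1.
Proof.
by rewrite big_ord_recl big_ord1; congr (_ + F _); apply: val_inj.
Qed.

Lemma det_mx2 {R : comNzRingType} (A : 'M[R]_2) :
  \det A = A 0 0 * A 1 1 - A 0 1 * A 1 0.
Proof.
rewrite (expand_det_row _ 0) big_ord2 /cofactor !det_mx11 !mxE /=.
have -> : lift 0 0 = 1 :> 'I_2 by apply: val_inj.
have -> : lift 1 0 = 0 :> 'I_2 by apply: val_inj.
by rewrite expr0 mul1r expr1 mulN1r mulrN.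
Qed.

Lemma matrix2P {R : Type} (A B : 'M[R]_2) :
  A 0 0 = B 0 0 -> A 0 1 = B 0 1 -> A 1 0 = B 1 0 -> A 1 1 = B 1 1 -> A = B.
Proof.
move=> h00 h01 h10 h11; apply/matrixP => i j.
have two (l : 'I_2) : l = 0 \/ l = 1.
  by case: l => [[|[|//]]] hl; [left | right]; apply: val_inj.
by case: (two i) => ->; case: (two j) => ->.
Qed.

Lemma mulmx2E {R : pzRingType} (A B : 'M[R]_2) i j :
  (A *m B) i j = A i 0 * B 0 j + A i 1 * B 1 j.
Proof. by rewrite mxE big_ord2. Qed.

Lemma char_poly2 {R : comNzRingType} (A : 'M[R]_2) :
  char_poly A = 'X^2 - (\tr A)%:P * 'X + (\det A)%:P.
Proof.
rewrite /char_poly !det_mx2 /mxtrace big_ord2 !mxE /= !(polyCB, polyCD, polyCM).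
by rewrite !mulr1n !mulr0n; ring.
Qed.

(** * Universality of nondegenerate binary quadratic forms *)

Section BinaryForms.
Context {k : fieldType}.

(** Take an isotropic vector (p, q, w) of the ternary form Q(p, q) - m w^2. If w is nonzero,
    dividing by it represents m. Otherwise Q itself is isotropic, and a nondegenerate isotropic form
    takes every value. *)
Lemma binary_form_universal (a b c m : k) : u_le2 k -> b ^+ 2 - 4 * a * c != 0 ->
  exists p q, a * p ^+ 2 + b * p * q + c * q ^+ 2 = m.
Proof.
move=> u_k disc_neq0.
(* An upper triangular coefficient matrix avoids halving b. *)
pose A : 'M[k]_3 := \matrix_(i, j)
  nth 0 (nth [::] [:: [:: a; b; 0]; [:: 0; c; 0]; [:: 0; 0; - m]] i) j.
have [v v_neq0] := u_k A.
rewrite /quad_form !big_ord_recl !big_ord0 !mxE /=.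
set i2 := lift _ (lift _ _); set i1 := lift _ _.
rewrite !mul0r ?mul0r ?addr0 ?add0r.
set p := v 0 0; set q := v 0 i1; set w := v 0 i2 => eq0.
have {}eq0 : a * p ^+ 2 + b * p * q + c * q ^+ 2 = m * w ^+ 2.
  by apply/eqP; rewrite -subr_eq0 -eq0; apply/eqP; ring.
have [w0|w_neq0] := eqVneq w 0; last first.
  by exists (p / w), (q / w); apply/(mulIf (expf_neq0 2 w_neq0)); rewrite -eq0; field.
have pq_neq0 : (p != 0) || (q != 0).
  apply: contraNT v_neq0; rewrite negb_or !negbK => /andP[/eqP p0 /eqP q0].
  apply/eqP/rowP => -[[|[|[|//]]] hi]; rewrite mxE.
  - by rewrite -p0; congr (v 0 _); apply: val_inj.
  - by rewrite -q0; congr (v 0 _); apply: val_inj.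
  - by rewrite -w0; congr (v 0 _); apply: val_inj.
rewrite w0 expr0n mulr0 in eq0.
(* If (p, q) is isotropic with polar form B, then Q(s (p, q) + r) is
   s B((p, q), r) + Q(r), affine in s. *)
have [B1|B1] := eqVneq (2 * a * p + b * q) 0; last first.
  pose s := (m - a) / (2 * a * p + b * q); exists (s * p + 1), (s * q).
  have sE : s * (2 * a * p + b * q) = m - a by rewrite divfK.
  transitivity (s ^+ 2 * (a * p ^+ 2 + b * p * q + c * q ^+ 2)
                + s * (2 * a * p + b * q) + a); first by ring.
  by rewrite eq0 sE; ring.
have [B2|B2] := eqVneq (b * p + 2 * c * q) 0; last first.
  pose s := (m - c) / (b * p + 2 * c * q); exists (s * p), (s * q + 1).
  have sE : s * (b * p + 2 * c * q) = m - c by rewrite divfK.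
  transitivity (s ^+ 2 * (a * p ^+ 2 + b * p * q + c * q ^+ 2)
                + s * (b * p + 2 * c * q) + c); first by ring.
  by rewrite eq0 sE; ring.
(* Now (p, q) lies in the radical of the polar form; by Cramer's rule the discriminant kills both
   coordinates. *)
have p0 : (b ^+ 2 - 4 * a * c) * p = 0.
  transitivity (b * (b * p + 2 * c * q) - 2 * c * (2 * a * p + b * q)); first by ring.
  by rewrite B1 B2; ring.
have q0 : (b ^+ 2 - 4 * a * c) * q = 0.
  transitivity (b * (2 * a * p + b * q) - 2 * a * (b * p + 2 * c * q)); first by ring.
  by rewrite B1 B2; ring.
move/eqP: p0; move/eqP: q0; rewrite !mulf_eq0 !(negbTE disc_neq0) /=.
by move=> /eqP q0 /eqP p0; rewrite p0 q0 eqxx in pq_neq0.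
Qed.

End BinaryForms.

(** * Conjugacy in SL2 through companion matrices *)

Section SL2Conjugacy.
Context {k : fieldType}.
Implicit Types x y z g h : SL2 k.

Lemma SL2_det2 x : x 0 0 * x 1 1 - x 0 1 * x 1 0 = 1.
Proof. by rewrite -det_mx2; exact/eqP/SL2_det. Qed.

Lemma SL2_tr2 x : \tr x = x 0 0 + x 1 1.
Proof. by rewrite /mxtrace big_ord2. Qed.

Lemma sl2_subproof (a b c d : k) : a * d - b * c = 1 ->
  \det (\matrix_(i < 2, j < 2) nth 0 (nth [::] [:: [:: a; b]; [:: c; d]] i) j) == 1.
Proof. by move=> h; rewrite det_mx2 !mxE /= h. Qed.

Definition sl2 (a b c d : k) (h : a * d - b * c = 1) : SL2 k :=
  MkSL2 (sl2_subproof a b c d h).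

Lemma SL2P x y : x 0 0 = y 0 0 -> x 0 1 = y 0 1 -> x 1 0 = y 1 0 ->
  x 1 1 = y 1 1 -> x = y.
Proof. by move=> ????; apply: val_inj; apply: matrix2P. Qed.

Lemma SL2_mulE x y i j : (x * y)%g i j = x i 0 * y 0 j + x i 1 * y 1 j.
Proof. exact: mulmx2E. Qed.

Lemma SL2_mul_conj x y g : (g * x = y * g)%g -> x = (y ^ g)%g.
Proof. by move=> h; rewrite conjgE -h mulKg. Qed.

Lemma SL2_tr_conj x g : \tr (x ^ g)%g = \tr x.
Proof.
have -> : SL2_mx (x ^ g)%g = invmx g *m (x *m g) by [].
by rewrite mxtrace_mulC mulmxK ?SL2_unit.
Qed.

Lemma companion_subproof (t : k) : 0 * t - 1 * (-1) = 1.
Proof. by ring. Qed.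

Lemma SL2_companion x : u_le2 k -> \tr x ^+ 2 != 4 ->
  exists g, x = (sl2 0 1 (-1) (\tr x) (companion_subproof _) ^ g)%g.
Proof.
move=> u_k tr_neq.
have det1 := SL2_det2 x; have tr := SL2_tr2 x.
(* The rows of g are v and v x; det g is a binary quadratic form in v, of
   discriminant tr(x)^2 - 4. *)
have [|p [q pq]] := binary_form_universal (x 0 1) (x 1 1 - x 0 0) (- x 1 0) 1 u_k.
  have -> : (x 1 1 - x 0 0) ^+ 2 - 4 * x 0 1 * - x 1 0
    = \tr x ^+ 2 - 4 * (x 0 0 * x 1 1 - x 0 1 * x 1 0) by rewrite tr; ring.
  by rewrite det1 mulr1 subr_eq0.
have hg : p * (p * x 0 1 + q * x 1 1) - q * (p * x 0 0 + q * x 1 0) = 1.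
  by rewrite -pq; ring.
exists (sl2 _ _ _ _ hg); apply: SL2_mul_conj.
apply: SL2P; rewrite !SL2_mulE !mxE /= ?tr; first by ring.
- by ring.
(* The second row is Cayley-Hamilton applied to v: v x^2 = tr(x) v x - v. The factor 1 is written
   out so that it can be replaced by det x. *)
- transitivity (- p * 1 + (x 0 0 + x 1 1) * (p * x 0 0 + q * x 1 0)); last by ring.
  by rewrite -det1; ring.
- transitivity (- q * 1 + (x 0 0 + x 1 1) * (p * x 0 1 + q * x 1 1)); last by ring.
  by rewrite -det1; ring.
Qed.

Lemma SL2_conj_of_tr x y : u_le2 k -> \tr x ^+ 2 != 4 -> \tr x = \tr y ->
  exists g, y = (x ^ g)%g.
Proof.
move=> u_k tr_neq tr_eq; have [g xE] := SL2_companion x u_k tr_neq.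
rewrite tr_eq in tr_neq xE; have [h yE] := SL2_companion y u_k tr_neq.
by exists (g^-1 * h)%g; rewrite [in RHS]xE -conjgM mulVKg.
Qed.

End SL2Conjugacy.

(** * Semisimple classes and the square of the trace *)

Section Semisimple.
Context {k : fieldType}.
Implicit Types x y z g h : SL2 k.

(** A quadratic polynomial without a root in [k] is irreducible, so a root can be adjoined. *)
Lemma sl2_char_poly_split x : exists (L : fieldType) (f : {rmorphism k -> L}) (r : L),
  root (map_poly f (char_poly x)) r.
Proof.
have [[r rx]|noroot] := pselect (exists r, root (char_poly x) r).
  by exists k, idfun, r; rewrite map_poly_id.
have irr : irreducible_poly (char_poly x).
  apply: cubic_irreducible; first by rewrite size_char_poly.
  by move=> r; apply/negP => rx; apply: noroot; exists r.
by have [L _ [r rL _]] := irredp_FAdjoin irr; exists L, (in_alg L), r.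
Qed.

(** Over [L] the eigenvalues r and s satisfy r s = 1; if they were equal, tr(x)^2 would be 4 r s =
    4. Distinct eigenvalues give diagonalizability. *)
Lemma semisimple_mx_SL2 x : \tr x ^+ 2 != 4 -> semisimple_mx x.
Proof.
move=> tr_neq; have [L [f [r]]] := sl2_char_poly_split x.
have := det_map_mx f x; rewrite (eqP (SL2_det x)) rmorph1 => det1.
rewrite map_char_poly => root_r; exists L, f.
set A := map_mx f x in det1 root_r *.
have trA : \tr A = f (\tr x) by rewrite trace_map_mx.
pose s := \tr A - r; have tr_rs : \tr A = r + s by rewrite /s; ring.
have rs : r * s = 1.
  move: root_r; rewrite char_poly2 det1 rootE !hornerE => /eqP eq0.
  by apply/eqP; rewrite -subr_eq0 -oppr_eq0 -eq0; apply/eqP; rewrite /s; ring.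
apply/diagonalizableP; exists [:: r; s]; last first.
  apply: (dvdp_trans (mxminpoly_dvd_char A)).
  rewrite !big_cons big_nil mulr1 char_poly2 det1 -rs.
  rewrite tr_rs polyCD polyCM.
  have -> : 'X^2 - (r%:P + s%:P) * 'X + r%:P * s%:P = ('X - r%:P) * ('X - s%:P) :> {poly L}.
    by ring.
  exact: dvdpp.
rewrite /= inE andbT; apply: contra tr_neq => /eqP rs_eq.
rewrite -(inj_eq (fmorph_inj f)) rmorphXn -trA rmorph_nat tr_rs; apply/eqP.
by transitivity (4 * (r * s)); [rewrite -rs_eq; ring | rewrite rs mulr1].
Qed.

(** Commuting with the lower and the upper elementary unipotent matrix makes [x] scalar, and a
    scalar matrix of determinant 1 has squared trace 4. *)
Lemma noncentral_tr x : \tr x ^+ 2 != 4 -> noncentral x.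
Proof.
move=> tr_neq cx; case/negP: tr_neq.
have h : (1 : k) * 1 - 0 * 1 = 1 by ring.
have h' : (1 : k) * 1 - 1 * 0 = 1 by ring.
have det1 := SL2_det2 x.
have := congr1 (fun y => SL2_mx y 0 0) (cx (sl2 _ _ _ _ h)).
have := congr1 (fun y => SL2_mx y 1 0) (cx (sl2 _ _ _ _ h)).
have := congr1 (fun y => SL2_mx y 0 0) (cx (sl2 _ _ _ _ h')).
rewrite /= !mulmx2E !mxE /= !mulr1 !mulr0 !mul1r !mul0r !addr0.
move=> e10 e11 e01.
have x10 : x 1 0 = 0 by apply: (addrI (x 0 0)); rewrite -e10 addr0.
have x11 : x 1 1 = x 0 0 by apply: (addrI (x 1 0)); rewrite e11 addrC.
have x01 : x 0 1 = 0 by apply: (addrI (x 0 0)); rewrite e01 addr0.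
rewrite SL2_tr2 x11; apply/eqP.
transitivity (4 * (x 0 0 * x 1 1 - x 0 1 * x 1 0)); last by rewrite det1 mulr1.
by rewrite x11 x01; ring.
Qed.

(** The squared difference of the eigenvalues is tr(x)^2 - 4. If it vanishes, the diagonal form is
    scalar, hence so is [x], since [f] is injective. *)
Lemma semisimple_tr_neq x : semisimple_mx x -> noncentral x -> \tr x ^+ 2 != 4.
Proof.
move=> [L [f [P Pu /(similar_diagLR Pu)[D fxE]]]] ncx.
apply/eqP => tr4; apply: ncx.
rewrite conjVmx // in fxE.
have trD : \tr (map_mx f x) = D 0 0 + D 0 1.
  by rewrite fxE mxtrace_mulC mulKVmx // mxtrace_diag big_ord2.
have detD : D 0 0 * D 0 1 = 1.
  transitivity (\det (map_mx f x)); last by rewrite det_map_mx (eqP (SL2_det x)) rmorph1.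
  rewrite fxE !det_mulmx mulrAC -det_mulmx mulVmx // det1 mul1r det_mx2 !mxE /=.
  by rewrite !mulr1n !mulr0n; ring.
have D_eq : D 0 0 = D 0 1.
  suff /eqP: (D 0 0 - D 0 1) ^+ 2 = 0 by rewrite expf_eq0 subr_eq0 => /eqP.
  transitivity ((D 0 0 + D 0 1) ^+ 2 - 4 * (D 0 0 * D 0 1)); first by ring.
  by rewrite -trD trace_map_mx -rmorphXn tr4 rmorph_nat detD; ring.
have scal : map_mx f x = (D 0 0)%:M.
  rewrite fxE -[RHS](mulKmx Pu) scalar_mxC mulmxA; congr (_ *m _ *m _).
  by apply: matrix2P; rewrite !mxE /= -?D_eq.
have fij i j : f (x i j) = (D 0 0) *+ (i == j) by move/matrixP/(_ i j): scal; rewrite !mxE.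
have x01 : x 0 1 = 0 by apply: (fmorph_inj f); rewrite fij rmorph0.
have x10 : x 1 0 = 0 by apply: (fmorph_inj f); rewrite fij rmorph0.
have x00 : x 0 0 = x 1 1 by apply: (fmorph_inj f); rewrite !fij.
by move=> y; apply: SL2P; rewrite !SL2_mulE ?x01 ?x10 ?x00; ring.
Qed.

Lemma psl_tr2 x y : psl x = psl y -> \tr x ^+ 2 = \tr y ^+ 2.
Proof. by move=> /pslP/orP[]/eqP-> //=; rewrite raddfN sqrrN. Qed.

Lemma semisimpleE x : semisimple k (psl x) <-> \tr x ^+ 2 != 4.
Proof.
split=> [[y [ss nc] /psl_tr2 <-]|tr_neq]; first exact: semisimple_tr_neq.
by exists x => //; split; [exact: semisimple_mx_SL2 | exact: noncentral_tr].
Qed.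

Lemma psl_conj x g : psl (x ^ g)%g = (psl x ^ psl g)%g.
Proof. by rewrite !conjgE !pslM pslV. Qed.

Lemma conj_class_psl x z :
  conj_class (psl x) (psl z) <-> exists g, psl (x ^ g)%g = psl z.
Proof.
split=> [[g _]|[g <-]]; last by exists (psl g) => //; rewrite psl_conj.
by elim/pslW: g => g <-; exists g; rewrite psl_conj.
Qed.

Lemma conj_class_tr x z : u_le2 k -> \tr x ^+ 2 != 4 ->
  conj_class (psl x) (psl z) <-> \tr z ^+ 2 = \tr x ^+ 2.
Proof.
move=> u_k tr_neq; rewrite conj_class_psl; split=> [[g /psl_tr2 <-]|].
  by rewrite SL2_tr_conj.
move/eqP; rewrite eqf_sqr => /orP[/eqP trz|/eqP trz].
  by have [g ->] := SL2_conj_of_tr x z u_k tr_neq (esym trz); exists g.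
have trNz : \tr x = \tr (SL2_opp z) by rewrite /= raddfN /= trz opprK.
by have [g gz] := SL2_conj_of_tr x _ u_k tr_neq trNz; exists g; rewrite -gz psl_opp.
Qed.

(** A simultaneous conjugation turns the second factor into [w] itself; the first factor then ranges
    over all elements with the trace of [x], up to sign in PSL2. *)
Lemma class_mulP x w z : u_le2 k -> \tr x ^+ 2 != 4 ->
  class_mul (conj_class (psl x)) (conj_class (psl w)) (psl z) <->
  exists2 y : SL2 k, \tr y = \tr x & conj_class (psl (y * w)%g) (psl z).
Proof.
move=> u_k tr_neq; split.
  move=> [_ [g _ <-] [_ [h _ <-]]]; elim/pslW: g => g; elim/pslW: h => h <-.
  exists (x ^ (g * h^-1))%g; first exact: SL2_tr_conj.
  exists (psl h) => //.
  by rewrite -!psl_conj -[RHS]pslM conjMg -conjgM mulgVK.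
move=> [y tr_y [h _ <-]]; elim/pslW: h => h.
have [g ->] := SL2_conj_of_tr x y u_k tr_neq (esym tr_y).
rewrite -psl_conj conjMg -conjgM pslM.
by exists (psl (x ^ (g * h))%g); [|exists (psl (w ^ h)%g)]; rewrite ?psl_conj //;
  [exists (psl (g * h)%g) | exists (psl h)].
Qed.

End Semisimple.

(** * Unipotent elements of the product *)

Section Unipotent.
Context {k : fieldType}.
Implicit Types (x y z g h : SL2 k) (e t r s : k).

Lemma unipE e : (unip e 0 0 = 1) * (unip e 0 1 = e) * (unip e 1 0 = 0) * (unip e 1 1 = 1).
Proof. by rewrite !mxE /= !mulr1n !mulr0n !mulr0 mulr1 !addr0 add0r. Qed.

Lemma SL2_mul_unip10 y e : (y * unip e)%g 1 0 = y 1 0.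
Proof. by rewrite SL2_mulE !unipE mulr1 mulr0 addr0. Qed.

Lemma SL2_tr_mul_unip y e : \tr (y * unip e)%g = \tr y + e * y 1 0.
Proof. by rewrite !SL2_tr2 !SL2_mulE !unipE; ring. Qed.

Lemma SL2_tr_unip e : \tr (unip e) = 2.
Proof. by rewrite SL2_tr2 !unipE. Qed.

Lemma conj_unip y e r : r != 0 -> e != 0 -> \tr y = 2 -> y 1 0 = - e * r ^+ 2 ->
  exists g, y = (unip e ^ g)%g.
Proof.
move=> r_neq0 e_neq0 tr_y y10; have det1 := SL2_det2 y.
have y11 : y 1 1 = 2 - y 0 0 by rewrite -tr_y SL2_tr2; ring.
(* With trace 2, the determinant condition reads - y01 y10 = (y00 - 1)^2. *)
have y01 : y 0 1 = (y 0 0 - 1) ^+ 2 / (e * r ^+ 2).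
  apply: (mulIf (mulf_neq0 e_neq0 (expf_neq0 2 r_neq0))); rewrite divfK; last first.
    by rewrite mulf_neq0 ?expf_neq0.
  transitivity (y 0 0 * y 1 1 - y 0 1 * y 1 0 - 1 + (y 0 0 - 1) ^+ 2).
    by rewrite y10 y11; ring.
  by rewrite det1; ring.
(* If (r, d) is the second row of g, then g^-1 u(e) g - 1 is e times the column (d, -r) times the
   row (r, d). Matching this with y - 1 gives d = (y00 - 1) / (e r); the first row is chosen to make
   det g = 1. *)
have hg : 0 * ((y 0 0 - 1) / (e * r)) - (- r^-1) * r = 1 by field; apply/andP.
exists (sl2 _ _ _ _ hg); apply: SL2_mul_conj.
by apply: SL2P; rewrite !SL2_mulE !unipE ?y11 ?y01 ?y10 !mxE /=; field; rewrite ?e_neq0 ?r_neq0.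
Qed.

(** Start from the product: the lower unipotent [w] with corner - e1 r^2 is conjugate to u(e1), and
    w u(e)^-1 has trace 2 + e e1 r^2. *)
Lemma tr_mul_unip_conj t e e1 r : r != 0 -> e1 != 0 -> t - 2 = e * e1 * r ^+ 2 ->
  exists2 y : SL2 k, \tr y = t & exists g, (y * unip e = unip e1 ^ g)%g.
Proof.
move=> r_neq0 e1_neq0 tE.
have hw : 1 * 1 - 0 * (- e1 * r ^+ 2) = 1 by ring.
pose w := sl2 _ _ _ _ hw.
have tr_w : \tr w = 2 by rewrite SL2_tr2 !mxE.
have w10 : w 1 0 = - e1 * r ^+ 2 by rewrite mxE.
have [g wE] := conj_unip w e1 r r_neq0 e1_neq0 tr_w w10.
have yE : (w * (unip e)^-1 * unip e = w)%g by rewrite mulgVK.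
exists (w * (unip e)^-1)%g; last by exists g; rewrite yE.
have := SL2_tr_mul_unip (w * (unip e)^-1)%g e.
have := SL2_mul_unip10 (w * (unip e)^-1)%g e.
rewrite yE tr_w w10 => <- /(canLR (addrK _)) <-.
by rewrite -[t](subrK 2) tE; ring.
Qed.

Lemma mul_unip_conj y e : e != 0 -> \tr y != 2 -> \tr (y * unip e)%g = 2 ->
  exists e1 g, [/\ e1 != 0, (y * unip e = unip e1 ^ g)%g & \tr y - 2 = e * e1].
Proof.
move=> e_neq0 tr_y tr_yu; have eq_tr := SL2_tr_mul_unip y e.
rewrite tr_yu in eq_tr.
have e1_neq0 : - y 1 0 != 0.
  by apply: contra tr_y; rewrite oppr_eq0 => /eqP y10; rewrite eq_tr y10 mulr0 addr0.
have [|g yuE] := conj_unip (y * unip e)%g (- y 1 0) 1 (oner_neq0 _) e1_neq0 tr_yu.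
  by rewrite SL2_mul_unip10; ring.
by exists (- y 1 0), g; split=> //; rewrite eq_tr; ring.
Qed.

Lemma conj_class_psl_conj x y z g :
  y = (x ^ g)%g -> conj_class (psl y) (psl z) <-> conj_class (psl x) (psl z).
Proof.
move=> ->; rewrite !conj_class_psl; split=> [[h <-]|[h <-]].
  by exists (g * h)%g; rewrite conjgM.
by exists (g^-1 * h)%g; rewrite -conjgM mulVKg.
Qed.

Lemma sqclass_refl e : sqclass e e.
Proof. by exists 1; [exists 1; rewrite ?expr1n //= oner_neq0 | rewrite mulr1]. Qed.

(** Replaces square classes by an explicit factor r^2, which also absorbs the change of
    representative of the class of [e1] allowed by [Delta]. *)
Lemma admissible_psl e x z : admissible e x (psl z) <->
  exists e1 r, [/\ e1 != 0, r != 0,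
    \tr x - 2 = e * e1 * r ^+ 2 \/ - \tr x - 2 = e * e1 * r ^+ 2
    & conj_class (psl (unip e1)) (psl z)].
Proof.
split=> [[y [e1 [e1_neq0 [e2 [e2_neq0 D] e12]]]]|[e1 [r [e1_neq0 r_neq0 D C]]]].
  move=> + yz; rewrite yz => C.
  have : sqclass e1 e2 by rewrite -e12; exact: sqclass_refl.
  case=> _ [r /= r_neq0 <-] e2E.
  case: D => -[_ [s /= s_neq0 <-] tE]; exists e1, (r * s);
    split; rewrite ?mulf_neq0 //; [left|right]; rewrite -tE -e2E; ring.
exists z => //; exists e1; split=> //; exists e1 => //; split=> //.
by case: D => ->; [left|right]; exists (r ^+ 2) => //; exists r.
Qed.

Lemma class_mul_unip x z e : u_le2 k -> \tr x ^+ 2 != 4 -> e != 0 -> \tr z ^+ 2 = 4 ->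
  class_mul (conj_class (psl x)) (conj_class (psl (unip e))) (psl z) <->
  admissible e x (psl z).
Proof.
move=> u_k tr_x e_neq0 tr_z; rewrite class_mulP // admissible_psl.
have four : 4 = 2 ^+ 2 :> k by rewrite -natrX.
have /norP[tr_x2 tr_x2'] : ~~ ((\tr x == 2) || (\tr x == - 2)) by rewrite -eqf_sqr -four.
split=> [[y tr_y C]|[e1 [r [e1_neq0 r_neq0 D C]]]].
  have tr_yu : \tr (y * unip e)%g ^+ 2 = 4.
    by case/conj_class_psl: C => g /psl_tr2; rewrite SL2_tr_conj tr_z.
  move/eqP: tr_yu; rewrite four eqf_sqr => /orP[]/eqP tr_yu.
    rewrite -tr_y in tr_x2.
    have [e1 [g [e1_neq0 yuE tE]]] := mul_unip_conj y e e_neq0 tr_x2 tr_yu.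
    exists e1, 1; split; rewrite ?oner_neq0 //; last exact/(conj_class_psl_conj _ _ _ _ yuE).
    by left; rewrite -tr_y tE expr1n mulr1.
  (* The product has trace -2; replacing [y] by its opposite produces the second alternative in
     [Delta]. *)
  have tr_yN : \tr (SL2_opp y) = - \tr x by rewrite /= raddfN /= tr_y.
  have tr_neq : \tr (SL2_opp y) != 2 by rewrite tr_yN eqr_oppLR.
  have tr_yuN : \tr (SL2_opp y * unip e)%g = 2.
    by rewrite SL2_opp_mull /= raddfN /= tr_yu opprK.
  have [e1 [g [e1_neq0 yuE tE]]] := mul_unip_conj _ e e_neq0 tr_neq tr_yuN.
  exists e1, 1; split; rewrite ?oner_neq0 //.
    by right; rewrite -tr_yN tE expr1n mulr1.
  by apply/(conj_class_psl_conj _ _ _ _ yuE); rewrite SL2_opp_mull psl_opp.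
case: D => D; have [y tr_y [g yuE]] := tr_mul_unip_conj _ _ _ _ r_neq0 e1_neq0 D.
  by exists y => //; exact/(conj_class_psl_conj _ _ _ _ yuE).
exists (SL2_opp y); first by rewrite /= raddfN /= tr_y opprK.
by rewrite SL2_opp_mull psl_opp; exact/(conj_class_psl_conj _ _ _ _ yuE).
Qed.

Lemma admissible_tr x z e : admissible e x (psl z) -> \tr z ^+ 2 = 4.
Proof.
case/admissible_psl => e1 [_ [_ _ _ /conj_class_psl[g /psl_tr2 <-]]].
by rewrite SL2_tr_conj SL2_tr_unip -natrX.
Qed.

End Unipotent.

(** * Semisimple elements of the product *)

Section SemisimplePart.
Context {k : fieldType}.
Implicit Types (x y z : SL2 k) (e t : k).

Lemma SL2_tr_lower t c : c != 0 -> exists2 y : SL2 k, \tr y = t & y 1 0 = c.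
Proof.
move=> c_neq0.
have hy : 0 * t - (- c^-1) * c = 1 by field.
by exists (sl2 _ _ _ _ hy); rewrite ?SL2_tr2 !mxE //= add0r.
Qed.

Lemma semisimple_in_class_mul x z e : u_le2 k -> (2 : k) != 0 -> \tr x ^+ 2 != 4 ->
  e != 0 -> \tr z ^+ 2 != 4 ->
  [\/ \tr x != 0, squares k (-1) | \tr z != 0] ->
  class_mul (conj_class (psl x)) (conj_class (psl (unip e))) (psl z).
Proof.
move=> u_k two_neq0 tr_x e_neq0 tr_z cond; apply/class_mulP => //.
(* The target trace [s] may be either sign of tr(z). The corner (s - tr(x)) / e is forced by the
   trace formula, and must be nonzero for [SL2_tr_lower]. *)
have sol (s : k) : s != \tr x -> s ^+ 2 = \tr z ^+ 2 ->
    exists2 y : SL2 k, \tr y = \tr x & conj_class (psl (y * unip e)%g) (psl z).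
  rewrite -subr_eq0 => s_neq s2.
  have [|y tr_y y10] := SL2_tr_lower (\tr x) ((s - \tr x) / e).
    by rewrite mulf_neq0 ?invr_neq0.
  have tr_yu : \tr (y * unip e)%g = s.
    by rewrite SL2_tr_mul_unip tr_y y10; field.
  by exists y => //; apply/conj_class_tr; rewrite // tr_yu s2.
have [tr_eq|tr_neq] := eqVneq (\tr z) (\tr x); last exact: sol tr_neq _.
have [x0|x_neq0] := eqVneq (\tr x) 0; last first.
  apply: (sol (- \tr z)); last by rewrite sqrrN.
  by rewrite tr_eq eq_sym -addr_eq0 -mulr2n -mulr_natl mulf_neq0.
case: cond; rewrite ?tr_eq x0 ?eqxx // => -[i /= i_neq0 i2].
(* With i^2 = -1, diag(i, -i) has trace 0 and zero corner, so multiplying it by u(e) keeps the trace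
   0. *)
have hy : i * (- i) - 0 * 0 = 1.
  by transitivity (- i ^+ 2); [ring | rewrite i2 opprK].
exists (sl2 _ _ _ _ hy); first by rewrite SL2_tr2 !mxE /= subrr.
have tr_yu : \tr (sl2 _ _ _ _ hy * unip e)%g = 0.
  by rewrite SL2_tr_mul_unip SL2_tr2 !mxE /= subrr mulr0 addr0.
by apply/conj_class_tr; rewrite // tr_yu -x0 // tr_eq.
Qed.

Lemma tr0_notin_class_mul x z e : u_le2 k -> \tr x ^+ 2 != 4 -> e != 0 ->
  \tr x = 0 -> \tr z = 0 -> ~ squares k (-1) ->
  ~ class_mul (conj_class (psl x)) (conj_class (psl (unip e))) (psl z).
Proof.
move=> u_k tr_x e_neq0 x0 z0 nsq /class_mulP[] // y tr_y /conj_class_psl[g /psl_tr2].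
rewrite SL2_tr_conj z0 SL2_tr_mul_unip tr_y x0 add0r expr0n /= => /eqP.
rewrite expf_eq0 mulf_eq0 (negbTE e_neq0) /= => /eqP y10.
have := SL2_det2 y; rewrite y10 mulr0 subr0.
have -> : y 1 1 = - y 0 0 by apply/eqP; rewrite -addr_eq0 addrC -SL2_tr2 tr_y x0.
rewrite mulrN -expr2 => /(canRL opprK) sq; apply: nsq; exists (y 0 0) => //=.
by apply/eqP => y00; move/eqP: sq; rewrite y00 expr0n eq_sym oppr_eq0 oner_eq0.
Qed.

(** The characteristic polynomial is X^2 + 1, a quadratic without roots. *)
Lemma tr0_nonsplit x : \tr x ^+ 2 != 4 -> \tr x = 0 -> ~ squares k (-1) ->
  nonsplit_semisimple k (psl x).
Proof.
move=> tr_x x0 nsq; exists x => //; split; [exact: semisimple_mx_SL2 | exact: noncentral_tr |].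
apply: cubic_irreducible; first by rewrite size_char_poly.
move=> r; apply/negP; rewrite char_poly2 (eqP (SL2_det x)) x0 rootE !hornerE subr0.
rewrite addr_eq0 => /eqP r2; apply: nsq; exists r => //=.
by apply: contra_eq_neq r2 => ->; rewrite expr0n eq_sym oppr_eq0 oner_neq0.
Qed.

End SemisimplePart.

Theorem theorem1p4 (k : fieldType)
    (u_k : u_le2 k)
    (not_quad_closed : ~ quadratically_closed k)
    (char_k : 2%N \notin [pchar k])
    (card_k : ([set: 'I_5] #<= [set: k])%card)
    (x : SL2 k) (x_ss : semisimple k (psl x))
    (e : k) (e_neq0 : e != 0) :
  let C1 := conj_class (psl x) in
  let C2 := conj_class (psl (unip e)) in
  (\tr x != 0 \/ squares k (-1) ->
     class_mul C1 C2 = semisimple k `|` admissible e x)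
  /\
  (\tr x = 0 /\ ~ squares k (-1) ->
     C1 `<=` nonsplit_semisimple k /\
     class_mul C1 C2 = (semisimple k `\` C1) `|` admissible e x).
Proof.
move=> C1 C2; have tr_x := (semisimpleE x).1 x_ss.
have two_neq0 : (2 : k) != 0 by move: char_k; rewrite inE /=.
split=> [cond|[x0 nsq]].
  apply/predeqP => g; elim/pslW: g => z /=; rewrite semisimpleE.
  (* Squared trace 4 singles out the unipotent images, the identity included; all other elements are
     semisimple. *)
  have [tr_z|tr_z] := eqVneq (\tr z ^+ 2) 4.
    by rewrite class_mul_unip //; split=> [|[]//]; right.
  split=> _; first by left.
  by apply: semisimple_in_class_mul => //; case: cond => ?; [exact: Or31 | exact: Or32].
(* In trace 0 the two signs coincide, so [C1] consists of all trace-zero elements; removing it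
   leaves exactly the semisimple targets with nonzero trace. *)
have C1E z : C1 (psl z) <-> \tr z = 0.
  rewrite /C1 conj_class_tr // x0 expr0n; split=> [/eqP|->]; last by rewrite expr0n.
  by rewrite expf_eq0 => /eqP.
split.
  elim/pslW=> z /[dup] /C1E z0 /(conj_class_tr _ _ u_k tr_x) tr_z.
  by apply: tr0_nonsplit => //; rewrite tr_z.
apply/predeqP => g; elim/pslW: g => z /=; rewrite semisimpleE C1E.
have [tr_z|tr_z] := eqVneq (\tr z ^+ 2) 4.
  by rewrite class_mul_unip //; split=> [|[[]//|//]]; right.
split=> [z_mul|[[_ /eqP z0]|/admissible_tr/eqP]]; last by rewrite (negbTE tr_z).
  by left; split=> // z0; apply: tr0_notin_class_mul z_mul.
by apply: semisimple_in_class_mul => //; exact: Or33.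
Qed.
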